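(* Let $S$ be a star graph with center $c$ and let $I$ be a subset of the leaves of $S$. The star inequalities, the bidirected-edge inequalities and the forked-tree inequality (defined below) form a minimal H-representation of $\mathrm{CIM}_S^I$. Moreover, $\mathrm{CIM}_S^I$ is a simplex.
   Context: A star graph with center $c$ is a tree on at least $3$ nodes in which every node other than $c$ is a leaf. Characteristic imsets: for a DAG $\mathcal{D}$ on a finite node set $V$ and $A\subseteq V$, $c_{\mathcal{D}}(A)=1$ if some $a\in A$ has every $b\in A\setminus\{a\}$ as a parent in $\mathcal{D}$, and $0$ otherwise. For a DAG $\mathcal{G}$ with skeleton $S$, $\mathcal{G}^I$ is obtained by adding a new node $u'$ and edge $u'\to u$ for each $u\in I$; $S^I$ is $S$ with these edges added. $\mathrm{CIM}_S^I=\mathrm{conv}\{c_{\mathcal{G}^I}:\mathcal{G}\text{ a DAG with skeleton }S\}$, regarded in the coordinates $x_A$ for $A$ with $c\in A\subseteq V(S)$, $|A|\ge3$, and $A=\{c,u,u'\}$, $u\in I$ (all other coordinates being constant on the polytope). Star inequalities: for each $V'$ with $c\in V'\subseteq V(S)$, $|V'|\ge3$: $\sum_{V'\subseteq A\subseteq V(S)}(-1)^{|A\setminus V'|}x_A\ge0$. Bidirected-edge inequalities: for each $u\in I$: $x_{cuu'}+\sum_{\emptyset\ne A\subseteq V(S)\setminus\{u,c\}}(-1)^{|A|+1}x_{A\cup\{u,c\}}\le1$. Forked-tree inequality: with $\mathbb{1}_{c\to L}(x)=\sum_{c\in A\subseteq V(S)\setminus L,\ |A|\ge3}\sum_{B\subseteq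 L}(-1)^{|A\cup B|-1}(|A|-2)x_{A\cup B}$ for $L$ a set of leaves, and $\#^{I}(x)=\sum_{c\in A\subseteq \{c\}\cup I,\ |A|\ge3}(-1)^{|A|-1}x_A$, the inequality is $\mathbb{1}_{c\to I}(x)+\sum_{u\in I}(1-x_{cuu'})\le1+\#^{I}(x)$. *)

(* Defs.v *)
From HB Require Import structures.
From mathcomp Require Import all_boot all_order all_algebra.
From mathcomp Require Import classical_sets.

Set Implicit Arguments.
Unset Strict Implicit.
Unset Printing Implicit Defensive.

Import Order.TTheory GRing.Theory Num.Theory.
Local Open Scope ring_scope.

(* Points and polytopes live in classical [set E] (delimiter %classic); subsets
   of node sets are finite sets [{set _}], whose notations are the default. *)

Section Graphs.
Variable V : finType.
Implicit Types (e d : rel V) (c v : V) (A : {set V}).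

Definition simple_graph e : Prop := symmetric e /\ irreflexive e.

(* In a simple graph, a cycle is a repetition-free closed walk on at least
   three nodes; [ucycle e [:: x; y]] merely traverses an edge back and forth. *)
Definition is_tree e : Prop :=
  [/\ simple_graph e, (forall x y, connect e x y)
    & (forall p : seq V, ucycle e p -> (size p < 3)%N)].

Definition is_leaf e v : bool := #|[set w | e v w]| == 1%N.

Definition star_graph e c : Prop :=
  [/\ is_tree e, (3 <= #|V|)%N & (forall v, v != c -> is_leaf e v)].

(* [d a b] is the arrow [a -> b]; loops are excluded as cycles of length 1. *)
Definition is_dag d : Prop := forall p : seq V, cycle d p -> p = [::].

Definition has_skeleton d e : Prop := forall x y, e x y = d x y || d y x.

Definition char_imset d A : bool :=
  [exists a in A, [forall b in A :\ a, d b a]].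

End Graphs.

Section Interventions.
Variables (V : finType) (I : {set V}).

(* [inl v] is the original node [v]; [inr u] is the added node [u']. *)
Definition inode : finType := (V + {x : V | x \in I})%type.

Definition intervention (d : rel V) : rel inode := fun x y =>
  match x, y with
  | inl a, inl b => d a b
  | inr u, inl b => val u == b
  | _, inr _ => false
  end.

Definition lift_set (A : {set V}) : {set inode} := [set inl v | v in A].

Definition arrow_set (c : V) (u : {x : V | x \in I}) : {set inode} :=
  [set inl c; inl (val u); inr u].

End Interventions.

Section ConvexGeometry.
Variables (R : realFieldType) (E : lmodType R).
Implicit Types (P : set E).

Definition conv_hull (X : set E) : set E :=
  [set x | exists (n : nat) (p : 'I_n -> E) (w : 'I_n -> R),
     [/\ (forall i, X (p i)), (forall i, 0 <= w i), \sum_(i < n) w i = 1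
       & x = \sum_(i < n) w i *: p i]]%classic.

Definition affinely_independent (n : nat) (p : 'I_n -> E) : Prop :=
  forall w : 'I_n -> R, \sum_(i < n) w i = 0 ->
    \sum_(i < n) w i *: p i = 0 -> forall i, w i = 0.

Definition is_simplex P : Prop :=
  exists (n : nat) (p : 'I_n.+1 -> E),
    affinely_independent p /\ P = conv_hull (range p).

Definition halfspace (H : set E) : Prop :=
  exists (f : {scalar E}) (b : R),
    (exists x, f x != 0) /\ H = [set x | f x <= b]%classic.

Definition H_representation (J : finType) P (H : J -> set E) (K : {set J}) :
    Prop :=
  (forall j, j \in K -> halfspace (H j)) /\
  P = [set x | forall j, j \in K -> H j x]%classic.

Definition minimal_H_representation (J : finType) P (H : J -> set E) : Prop :=
  H_representation P H [set: J] /\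
  forall K : {set J}, K \proper [set: J] -> ~ H_representation P H K.

End ConvexGeometry.

Section CIM.
(* [R^o] is [R] as a module over itself, so that points form an lmodType. *)
Variables (R : realFieldType) (V : finType) (S : rel V) (c : V) (I : {set V}).

Local Notation fullpoint := {ffun {set inode I} -> R^o}.

Definition imset_vector (D : rel (inode I)) : fullpoint :=
  [ffun A => (char_imset D A)%:R].

Definition CIM_full : set fullpoint :=
  conv_hull [set imset_vector (intervention (I := I) G)
            | G in [set G : rel V | is_dag G /\ has_skeleton G S]%classic]%classic.

Definition is_coord (A : {set inode I}) : bool :=
  [exists B : {set V}, [&& c \in B, (3 <= #|B|)%N & A == lift_set I B]]
  || [exists u : {x : V | x \in I}, A == arrow_set c u].

Definition coord : finType := {A : {set inode I} | is_coord A}.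

Local Notation point := {ffun coord -> R^o}.

Definition restrict (x : fullpoint) : point :=
  [ffun k : coord => x (val k)].

Definition CIM : set point := (restrict @` CIM_full)%classic.

(* The value 0 off the coordinates is junk: the inequalities below only
   evaluate [entry] at coordinates, cf. [is_coord_lift] and [is_coord_arrow]. *)
Definition entry (x : point) (A : {set inode I}) : R :=
  if insub A is Some k then x k else 0.

Implicit Types (x : point) (A B L : {set V}).

Definition xset x A : R := entry x (lift_set I A).
Definition xarrow x (u : {x : V | x \in I}) : R := entry x (arrow_set c u).

Definition star_lhs B x : R :=
  \sum_(A : {set V} | B \subset A) (-1) ^+ #|A :\: B| * xset x A.

Definition bidirected_lhs (u : {x : V | x \in I}) x : R :=
  xarrow x u +
  \sum_(A : {set V} | (A != finset.set0) && (A \subset ~: [set val u; c]))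
    (-1) ^+ #|A|.+1 * xset x (A :|: [set val u; c]).

Definition toward_leaves L x : R :=
  \sum_(A : {set V} | [&& c \in A, A \subset ~: L & (3 <= #|A|)%N])
    \sum_(B : {set V} | B \subset L)
      (-1) ^+ (#|A :|: B| - 1) * (#|A| - 2)%:R * xset x (A :|: B).

Definition sharpI x : R :=
  \sum_(A : {set V} | [&& c \in A, A \subset c |: I & (3 <= #|A|)%N])
    (-1) ^+ (#|A| - 1) * xset x A.

Definition forked_lhs x : R :=
  toward_leaves I x + \sum_(u : {x : V | x \in I}) (1 - xarrow x u).

Definition star_index : finType :=
  {B : {set V} | (c \in B) && (3 <= #|B|)%N}.

Definition ineq_index : finType :=
  (star_index + {x : V | x \in I} + unit)%type.

Definition ineq (j : ineq_index) : set point :=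
  match j with
  | inl (inl B) => [set x | 0 <= star_lhs (val B) x]%classic
  | inl (inr u) => [set x | bidirected_lhs u x <= 1]%classic
  | inr tt => [set x | forked_lhs x <= 1 + sharpI x]%classic
  end.

Lemma is_coord_lift A : c \in A -> (3 <= #|A|)%N -> is_coord (lift_set I A).
Proof.
by move=> cA A3; apply/orP; left; apply/existsP; exists A; rewrite cA A3 eqxx.
Qed.

Lemma is_coord_arrow u : is_coord (arrow_set c u).
Proof. by apply/orP; right; apply/existsP; exists u. Qed.

End CIM.

Arguments CIM R {V} S c I.
Arguments ineq R {V} c I j.

(* Main.v *)
(* A DAG with the star as skeleton is determined by the set P of parents of c;
   at the corresponding point, x_A = [A \ c is a subset of P] and
   x_cuu' = [u is not in P].  By inclusion-exclusion, the slack of the star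
   inequality of V' there is [P = V' \ c], that of the bidirected-edge
   inequality of u is [P = {u}], and that of the forked-tree inequality is 1
   exactly when P is empty or a single leaf outside I (all these P give the
   same point).  Hence the slacks are dual to the vertices; as there is exactly
   one more of them than coordinates, they are the barycentric coordinates of
   a simplex. *)
From HB Require Import structures.
Require Import Defs.
From mathcomp Require Import all_boot all_order all_algebra.
From mathcomp Require Import classical_sets.
From mathcomp Require Import fintype finset.

Set Implicit Arguments.
Unset Strict Implicit.
Unset Printing Implicit Defensive.

Import Order.TTheory GRing.Theory Num.Theory.
Local Open Scope ring_scope.

(** * Affine functionals and simplices given by dual barycentric coordinates *)

Section Simplex.
Variables (R : realFieldType) (E : vectType R).

(** Amounts to linearity of [s - s 0]; a single equation makes closure under sums and scaling a
    matter of rewriting. *)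
Definition affine (s : E -> R) : Prop :=
  forall a x y, s (a *: x + y) = a * s x + s y - a * s 0.

Lemma affine_cst b : affine (fun=> b).
Proof. by move=> a x y; rewrite addrC addKr. Qed.

Lemma affineD s t : affine s -> affine t -> affine (fun x => s x + t x).
Proof.
move=> As At a x y; rewrite As At !mulrDr opprD addrACA; congr (_ + _).
exact: addrACA.
Qed.

Lemma affineM b s : affine s -> affine (fun x => b * s x).
Proof.
by move=> As a x y; rewrite As mulrBr mulrDr !(mulrCA b).
Qed.

Lemma affineB s t : affine s -> affine t -> affine (fun x => s x - t x).
Proof.
move=> As At a x y; have := affineD As (affineM (-1) At) a x y.
by rewrite !mulN1r.
Qed.

Lemma affine_sum (T : finType) (Q : pred T) (F : T -> E -> R) :
  (forall i, Q i -> affine (F i)) -> affine (fun x => \sum_(i | Q i) F i x).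
Proof.
move=> AF a x y; rewrite !mulr_sumr -big_split -sumrB.
by apply: eq_bigr => i /AF ->.
Qed.

Lemma affine_combination s (T : finType) (p : T -> E) (w : T -> R) :
  affine s -> \sum_i w i = 1 -> s (\sum_i w i *: p i) = \sum_i w i * s (p i).
Proof.
move=> As w1.
(* Weights over a partial list need not sum to 1; the defect multiplies [s 0]. *)
suff H (r : seq T) : s (\sum_(i <- r) w i *: p i) =
    \sum_(i <- r) w i * s (p i) + (1 - \sum_(i <- r) w i) * s 0.
  by rewrite H w1 subrr mul0r addr0.
elim: r => [|i r IH]; first by rewrite !big_nil subr0 mul1r add0r.
rewrite !big_cons As IH opprD addrA -!addrA; congr (_ + _); congr (_ + _).
by rewrite addrCA [RHS]mulrDl mulNr addrC.
Qed.

Lemma affine_halfspace s x y : affine s -> s x != s y ->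
  halfspace [set z | 0 <= s z]%classic.
Proof.
move=> As sxy.
have lin : scalar (fun z => s 0 - s z).
  move=> a u v /=; rewrite As mulrBr !opprD opprK addrCA.
  by rewrite [RHS]addrACA [RHS]addrC [a * s 0 + _]addrC.
pose f : {scalar E} := HB.pack (fun z => s 0 - s z : R^o)
  (GRing.isLinear.Build R E R^o *%R (fun z => s 0 - s z) lin).
exists f, (s 0); split.
  (* If [f] vanished at both points, [s x] and [s y] would both equal [s 0]. *)
  have [fx|] := eqVneq (f x) 0; last by exists x.
  exists y; apply: contra_neq sxy => fy.
  by move/eqP: fx; move/eqP: fy; rewrite !subr_eq0 => /eqP <- /eqP <-.
by apply/seteqP; split=> z /=; rewrite gerBl.
Qed.

Section DualBasis.
Variables (J : finType) (p : J -> E) (s : J -> E -> R).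
Hypotheses (aff_s : forall j, affine (s j))
  (dual : forall j k, s j (p k) = (j == k)%:R)
  (dimE : (\dim {:E} < #|J|)%N).

Lemma dual_combination (w : J -> R) : \sum_j w j = 1 ->
  forall k, s k (\sum_j w j *: p j) = w k.
Proof.
move=> w1 k; rewrite affine_combination // (bigD1 k) //= dual eqxx mulr1.
by rewrite big1 ?addr0 // => j jk; rewrite dual eq_sym (negPf jk) mulr0.
Qed.

(** Adding [w] to the unit weights at [k] changes neither their sum nor the point [p k]; evaluating
    [s k] there gives [1 + w k = 1]. *)
Lemma dual_affinely_independent (w : J -> R) : \sum_j w j = 0 ->
  \sum_j w j *: p j = 0 -> forall j, w j = 0.
Proof.
move=> w0 wp0 k.
pose v j := (j == k)%:R + w j.
have v1 : \sum_j v j = 1.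
  rewrite big_split /= w0 addr0 (bigD1 k) //= eqxx big1 ?addr0 // => j.
  by move/negPf->.
have vp : \sum_j v j *: p j = p k.
  under eq_bigr do rewrite scalerDl.
  rewrite big_split /= wp0 addr0 (bigD1 k) //= eqxx scale1r big1 ?addr0 // => j.
  by move/negPf->; rewrite scale0r.
have := dual_combination v1 k; rewrite vp dual eqxx /v eqxx.
by move=> /esym/eqP; rewrite -subr_eq0 addrAC subrr add0r => /eqP.
Qed.

(* Homogenizing, the vectors (p_j, 1) are independent, and there are at least
   dim (E * R) of them, so they span. *)
Lemma dual_barycentric x :
  \sum_j s j x = 1 /\ x = \sum_j s j x *: p j.
Proof.
pose q (i : 'I_#|J|) : (E * R^o)%type := (p (enum_val i), 1).
pose X := [tuple q i | i < #|J|].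
have sumE (a : 'I_#|J| -> R) : \sum_i a i *: X`_i =
    (\sum_j a (enum_rank j) *: p j, \sum_j a (enum_rank j)).
  have -> : \sum_i a i *: X`_i = \sum_j a (enum_rank j) *: (p j, 1 : R^o).
    rewrite (reindex enum_rank) /=; last first.
      by apply: onW_bij; apply: enum_rank_bij.
    by apply: eq_bigr => j _; rewrite (nth_map (enum_rank j)) ?size_enum_ord //
      nth_ord_enum /q enum_rankK.
  rewrite [LHS]surjective_pairing !raddf_sum.
  by congr (_, _); apply: eq_bigr => j _ //=; rewrite /GRing.scale /= mulr1.
have freeX : free X.
  apply/freeP => a; rewrite sumE => -[wp0 w0] i.
  by have := dual_affinely_independent w0 wp0 (enum_val i); rewrite enum_valK.
have spanX : (<<X>> = fullv)%VS.
  apply/eqP; rewrite -dimv_leqif_eq ?subvf // eqn_leq dimvS ?subvf //=.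
  move/eqP: freeX; rewrite /free => ->; rewrite size_tuple.
  by move: dimE; rewrite !dimvf /dim /= addn1.
have xX : (x, 1 : R^o) \in <<X>>%VS by rewrite spanX memvf.
have := coord_span xX; rewrite sumE => -[xE w1].
(* The last component makes the coordinates of [(x, 1)] sum to 1, so duality identifies them with
   the values [s j x]. *)
have sE j : s j x = coord X (enum_rank j) (x, 1 : R^o).
  by rewrite {1}xE (dual_combination (esym w1)).
by split; [rewrite [RHS]w1|rewrite [LHS]xE]; apply: eq_bigr => j _; rewrite sE.
Qed.

(** Each [s j] is nonnegative at the vertices, hence on their hull; conversely, nonnegative
    barycentric coordinates are convex weights. *)
Lemma conv_hull_dual :
  conv_hull (range p) = [set x | forall j, 0 <= s j x]%classic.
Proof.
apply/seteqP; split=> [x [n [y [w [yp w0 w1 ->]]]] j|x /= s0].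
  rewrite affine_combination //; apply: sumr_ge0 => i _.
  by rewrite mulr_ge0 //; have [k _ <-] := yp i; rewrite dual.
have [s1 xE] := dual_barycentric x.
exists #|J|, (p \o enum_val), (fun i => s (enum_val i) x); split=> //.
- by rewrite -s1 [RHS](reindex (@enum_val J J)) //; apply: onW_bij;
    apply: enum_val_bij.
- by rewrite {1}xE [LHS](reindex (@enum_val J J)) //; apply: onW_bij;
    apply: enum_val_bij.
Qed.

Lemma dual_is_simplex : is_simplex (conv_hull (range p)).
Proof.
(* [is_simplex] indexes the vertices by ['I_n.+1], so [J] must be nonempty and is renumbered through
   [e]. *)
have J0 : (0 < #|J|)%N by apply: leq_ltn_trans dimE.
have JE : (#|J|.-1.+1 = #|J|)%N by rewrite prednK.
pose e i : J := enum_val (cast_ord JE i).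
pose e' j := cast_ord (esym JE) (enum_rank j).
have eK : cancel e e' by move=> i; rewrite /e /e' enum_valK cast_ordK.
have e'K : cancel e' e by move=> j; rewrite /e /e' cast_ordKV enum_rankK.
have bij_e : bijective e by exists e'.
have bij_e' : bijective e' by exists e.
exists #|J|.-1, (p \o e); split.
  move=> w w0 wp0 i; rewrite -(eK i).
  apply: (@dual_affinely_independent (w \o e')).
    by apply: etrans w0; rewrite [RHS](reindex e') //; exact: onW_bij.
  apply: etrans wp0; rewrite [RHS](reindex e') /=; last exact: onW_bij.
  by apply: eq_bigr => j _; rewrite e'K.
congr conv_hull; apply/seteqP; split=> x [].
  by move=> j _ <-; exists (e' j); rewrite //= e'K.
by move=> i _ <-; exists (e i).
Qed.

Lemma dual_minimal_H_representation : (1 < #|J|)%N ->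
  minimal_H_representation (conv_hull (range p))
    (fun j => [set x | 0 <= s j x]%classic).
Proof.
move=> J2.
(* A second vertex makes each [s j] nonconstant, and also serves to build the point violating a
   dropped inequality. *)
have other (j : J) : exists k, k != j.
  have : (0 < #|[set~ j]|)%N by rewrite cardsC1 -ltnS prednK ?(ltnW J2).
  by case/card_gt0P => k; rewrite !inE; exists k.
split.
  split=> [j _|].
    have [k kj] := other j; apply: (@affine_halfspace _ (p j) (p k)) => //.
    by rewrite !dual eqxx (eq_sym j) (negPf kj) oner_eq0.
  rewrite conv_hull_dual; apply/seteqP; split=> x /= H j; first by move=> _.
  exact: H.
move=> K /properP[_ [j _ jK]] [_ PE].
have [k kj] := other j.
(* Reflecting p_j through p_k violates the j-th inequality only. *)
pose y := 2 *: p k + -1 *: p j.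
(* The point [y] is an affine combination of the vertices, so its slacks are its weights. *)
have sy i : s i y = 2 * (i == k)%:R - (i == j)%:R.
  pose w l : R := 2 * (l == k)%:R - (l == j)%:R.
  have sum_delta l : \sum_m (m == l)%:R = 1 :> R.
    by rewrite (bigD1 l) //= eqxx big1 ?addr0 // => m /negPf->.
  have sum_deltap l : \sum_m (m == l)%:R *: p m = p l.
    rewrite (bigD1 l) //= eqxx scale1r big1 ?addr0 // => m /negPf->.
    by rewrite scale0r.
  have w1 : \sum_l w l = 1.
    by rewrite sumrB -mulr_sumr !sum_delta mulr1 -[2]/(1 + 1) addrK.
  have -> : y = \sum_l w l *: p l.
    under eq_bigr do rewrite scalerBl -scalerA.
    by rewrite sumrB -scaler_sumr !sum_deltap /y scaleN1r.
  by rewrite dual_combination.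
have : conv_hull (range p) y.
  rewrite PE => i iK /=; rewrite sy.
  have -> : i == j = false by apply: contraNF jK => /eqP <-.
  by rewrite subr0 mulr_ge0.
rewrite conv_hull_dual => /(_ j).
by rewrite sy eqxx (eq_sym j) (negPf kj) mulr0 sub0r oppr_ge0 ler10.
Qed.

End DualBasis.
End Simplex.

(** Restricting to the chosen coordinates is linear, so [CIM] is the hull of the restricted imsets.
    Preimages of the points are chosen and recombined with the same weights. *)
Lemma conv_hull_linear_image (R : realFieldType) (E F : lmodType R)
    (f : {linear E -> F}) (X : set E) :
  (f @` conv_hull X = conv_hull (f @` X))%classic.
Proof.
apply/seteqP; split=> [_ [_ [n [y [w [yX w0 w1 ->]]]] <-]|].
  exists n, (f \o y), w; split=> // [i|]; first by exists (y i).
  by rewrite linear_sum; apply: eq_bigr => i _; rewrite linearZ.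
move=> _ [n [y [w [yX w0 w1 ->]]]].
have /boolp.choice[z zX] i : exists u, X u /\ f u = y i.
  by have [u Xu <-] := yX i; exists u.
exists (\sum_i w i *: z i).
  by exists n, z, w; split=> // i; case: (zX i).
by rewrite linear_sum; apply: eq_bigr => i _; rewrite linearZ;
  case: (zX i) => _ ->.
Qed.

(** * Alternating sums over Boolean lattices *)

Section AlternatingSums.
Variables (R : realFieldType) (T : finType).
Implicit Types (A B P Q : {set T}) (x : T).

Lemma sum_interval (F : {set T} -> R) B Q : B \subset Q ->
  \sum_(A : {set T} | (B \subset A) && (A \subset Q)) F A =
  \sum_(A : {set T} | A \subset Q :\: B) F (B :|: A).
Proof.
move=> BQ; rewrite (reindex_onto (fun A => B :|: A) (fun A => A :\: B)) /=.
  apply: eq_bigl => A; rewrite subsetUl subUset BQ /= subsetD.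
  congr (_ && _); rewrite -setI_eq0; apply/eqP/eqP => [<-|AB].
    by rewrite setIC setIDA setIC -setIDA setDv setI0.
  rewrite setDUl setDv set0U.
  by apply/setDidPl; rewrite -setI_eq0 AB.
by move=> A /andP[BA _]; rewrite setUC setDE setUIl [_ :|: B]setUC
  [~: B :|: B]setUC setUCr setIT; apply/setUidPr.
Qed.

(** Pairing each [A] with [x |: A] is the source of the cancellations below. *)
Lemma sum_subsetU1 (F : {set T} -> R) x P : x \notin P ->
  \sum_(A : {set T} | A \subset x |: P) F A =
  \sum_(A : {set T} | A \subset P) (F A + F (x |: A)).
Proof.
move=> xP; rewrite (bigID (fun A : {set T} => x \in A)) /= addrC big_split /=.
congr (_ + _).
  by apply: eq_bigl => A; rewrite -subsetD1 setU1K.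
under eq_bigl do rewrite andbC -sub1set.
by rewrite sum_interval ?subsetUl // setU1K.
Qed.

Lemma sum_sign P :
  \sum_(A : {set T} | A \subset P) (-1) ^+ #|A| = (P == set0)%:R :> R.
Proof.
have [->|[x xP]] := set_0Vmem P.
  under eq_bigl do rewrite subset0.
  by rewrite big_pred1_eq cards0 eqxx.
rewrite -(setD1K xP) sum_subsetU1 ?setD11 //.
rewrite big1 => [|A]; last first.
  rewrite subsetD1 => /andP[_ xA].
  by rewrite cardsU1 xA exprS mulN1r subrr.
case: eqP => // /setP/(_ x); by rewrite !inE eqxx.
Qed.

(** The pair [A], [x |: A] contributes [- (-1) ^+ #|A|], which reduces the sum to [sum_sign] on
    [P :\ x], a set that is empty exactly when [P] is a singleton. *)
Lemma sum_sign_card P :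
  \sum_(A : {set T} | A \subset P) (-1) ^+ #|A| * #|A|%:R
    = - (#|P| == 1)%:R :> R.
Proof.
have [->|[x xP]] := set_0Vmem P.
  under eq_bigl do rewrite subset0.
  by rewrite big_pred1_eq cards0 mulr0 oppr0.
rewrite -(setD1K xP) sum_subsetU1 ?setD11 //.
rewrite cardsU1 setD11 add1n eqSS cards_eq0 -sum_sign -sumrN.
apply: eq_bigr => A; rewrite subsetD1 => /andP[_ xA].
by rewrite cardsU1 xA add1n exprS mulN1r mulNr -natr1 mulrDr mulr1 opprD
  addrA subrr add0r.
Qed.

(** Möbius inversion in the Boolean lattice: the interval from [B] to [Q] is the power set of
    [Q :\: B]. *)
Lemma sum_sign_interval B Q :
  \sum_(A : {set T} | (B \subset A) && (A \subset Q)) (-1) ^+ #|A :\: B|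
    = (B == Q)%:R :> R.
Proof.
have [BQ|BQ] := boolP (B \subset Q); last first.
  rewrite big_pred0 => [|A]; first by case: eqP BQ => // ->; rewrite subxx.
  by apply: contraNF BQ => /andP[]; apply: subset_trans.
rewrite (sum_interval (fun A => (-1) ^+ #|A :\: B|)) // eqEsubset BQ /=.
rewrite -setD_eq0 -sum_sign; apply: eq_bigr => A.
rewrite subsetD => /andP[_ AB]; congr (_ ^+ #|pred_of_set _|).
by rewrite setDUl setDv set0U; apply/setDidPl.
Qed.

Lemma sum_sign_nonempty P :
  \sum_(A : {set T} | (A != set0) && (A \subset P)) (-1) ^+ #|A|.+1
    = 1 - (P == set0)%:R :> R.
Proof.
rewrite -sum_sign [in RHS](bigD1 set0) ?sub0set //=.
rewrite cards0 expr0 opprD addrA subrr add0r -sumrN.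
under eq_bigl do rewrite andbC.
by apply: eq_bigr => A _; rewrite exprS mulN1r.
Qed.

(** From the full sum, the empty set removes 1 and each singleton removes -1. *)
Lemma sum_sign_ge2 P :
  \sum_(A : {set T} | (A \subset P) && (2 <= #|A|)%N) (-1) ^+ #|A|
    = (P == set0)%:R - 1 + #|P|%:R :> R.
Proof.
have E : \sum_(A : {set T} | A \subset P) (#|A| == 1)%:R = #|P|%:R :> R.
  rewrite -(bin1 #|P|) -cards_draws -natr_sum -sum1_card big_mkcond.
  rewrite [in RHS]big_mkcond; congr _%:R; apply: eq_bigr => A _.
  by rewrite inE; case: (A \subset P).
have E0 : \sum_(A : {set T} | A \subset P) (A == set0)%:R = 1 :> R.
  rewrite (bigD1 set0) ?sub0set //= eqxx big1 ?addr0 // => A.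
  by move=> /andP[_ /negPf->].
rewrite -sum_sign -{}E -[X in _ - X + _]E0 -sumrB -big_split big_mkcondr.
apply: eq_bigr => A _; rewrite -cards_eq0; case: #|A| => [|[|n]] //=.
- by rewrite subrr addr0.
- by rewrite subr0 addNr.
- by rewrite subr0 addr0.
Qed.

Lemma sum_sign_pred P :
  \sum_(A : {set T} | (A \subset P) && (2 <= #|A|)%N)
     (-1) ^+ #|A| * (#|A| - 1)%:R = (2 <= #|P|)%N%:R :> R.
Proof.
(* The weight [#|A| - 1], taken in the ring, vanishes on singletons and is -1 at the empty set; the
   last term corrects the latter. *)
have -> : \sum_(A : {set T} | (A \subset P) && (2 <= #|A|)%N)
     (-1) ^+ #|A| * (#|A| - 1)%:R = \sum_(A : {set T} | A \subset P)
     ((-1) ^+ #|A| * #|A|%:R - (-1) ^+ #|A| + (A == set0)%:R) :> R.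
  rewrite big_mkcondr; apply: eq_bigr => A _.
  rewrite -cards_eq0; case: #|A| => [|[|n]] /=.
  - by rewrite mulr0 sub0r addNr.
  - by rewrite mulr1 subrr addr0.
  - by rewrite addr0 subn1 -[in RHS]natr1 mulrDr mulr1 addrK.
rewrite big_split sumrB /= sum_sign sum_sign_card (bigD1 set0) ?sub0set //=.
rewrite eqxx big1 ?addr0 => [|A /andP[_ /negPf->]] //.
rewrite -cards_eq0; case: #|P| => [|[|n]] /=.
- by rewrite oppr0 sub0r addNr.
- by rewrite subr0 addNr.
- by rewrite oppr0 !add0r.
Qed.
End AlternatingSums.

(** * Orientations of a star and their characteristic imsets *)

Section StarDags.
Variables (V : finType) (S : rel V) (c : V).
Implicit Types (D : rel V) (P : {set V}).

Lemma dag_irr D x : is_dag D -> D x x = false.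
Proof.
move=> dagD; apply/negP => Dxx.
by have := dagD [:: x]; rewrite /= Dxx => /(_ isT).
Qed.

Lemma dag_asym D x y : is_dag D -> D x y -> D y x = false.
Proof.
move=> dagD Dxy; apply/negP => Dyx.
by have := dagD [:: x; y]; rewrite /= Dxy Dyx => /(_ isT).
Qed.

Lemma ranked_dag D (h : V -> nat) :
  (forall x y, D x y -> (h x < h y)%N) -> is_dag D.
Proof.
move=> hD [|x p] //= cyc.
have sub : subrel D (relpre h ltn) by move=> y z /hD.
have tr : transitive (relpre h ltn) by move=> y z w; apply: ltn_trans.
(* The closed walk ends at [x], so transitivity would put the rank of [x] below itself. *)
have := order_path_min tr (sub_path sub cyc).
by rewrite all_rcons /= ltnn.
Qed.

Hypothesis starS : star_graph S c.

(** Were the only neighbour [w] of [v] not the center, [w] would be a leaf too, and [[set v; w]]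
    would be a connected component missing [c]. *)
Lemma star_center v : v != c -> S c v.
Proof.
case: starS => [[[symS irrS] conS _] _ leafS] vc.
have [w Nv] := cards1P (leafS v vc).
have Sv x : S v x = (x == w) by have := in_set1 x w; rewrite -Nv inE.
have Svw : S v w by rewrite Sv.
have [<-|wc] := eqVneq w c; first by rewrite symS.
have [w' Nw] := cards1P (leafS w wc).
have Sw x : S w x = (x == v).
  have Sw' y : S w y = (y == w') by have := in_set1 y w'; rewrite -Nw inE.
  by move: Svw; rewrite symS !Sw' => /eqP ->.
have cl : closed S (mem [set v; w]).
  move=> x y Sxy; rewrite !inE; apply/idP/idP.
    by case/orP => /eqP xE; move: Sxy; rewrite xE ?Sv ?Sw => ->; rewrite ?orbT.
  by case/orP => /eqP yE; move: Sxy; rewrite symS yE ?Sv ?Sw => ->;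
    rewrite ?orbT.
have := closed_connect cl (conS v c).
by rewrite !inE eqxx /= ![c == _]eq_sym (negPf vc) (negPf wc).
Qed.

Lemma star_edgeE x y : S x y = (x != y) && ((x == c) || (y == c)).
Proof.
have [[[symS irrS] _ _] _ leafS] := starS.
have [->|xy] /= := eqVneq x y; first exact: irrS.
have [xc|xc] /= := eqVneq x c.
  by rewrite xc star_center // -xc eq_sym.
have [->|yc] := eqVneq y c; first by rewrite symS star_center.
have [w Nx] := cards1P (leafS x xc).
have Sx z : S x z = (z == w) by have := in_set1 z w; rewrite -Nx inE.
have : S x c by rewrite symS star_center.
by rewrite !Sx => /eqP <-; apply: negPf.
Qed.

(** The center has degree [#|V| - 1], at least 2; this keeps [c] out of [I]. *)
Lemma center_not_leaf : ~~ is_leaf S c.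
Proof.
have [_ V3 _] := starS; rewrite /is_leaf.
have -> : [set w | S c w] = [set~ c].
  by apply/setP => w; rewrite !inE star_edgeE eqxx andbT eq_sym.
by rewrite cardsC1; case: #|V| V3 => [|[|[|n]]].
Qed.

(** The orientation of the star in which [P] is the set of parents of [c]; excluding [c] among the
    children avoids a loop. *)
Definition star_dag P : rel V :=
  fun x y => (x \in P) && (y == c) || (x == c) && (y \notin c |: P).

Lemma star_dag_dag P : c \notin P -> is_dag (star_dag P).
Proof.
(* Rank 0 for parents of the center, 1 for the center, 2 for its children. *)
move=> cP; apply: (@ranked_dag _ (fun x =>
  if x \in P then 0%N else if x == c then 1%N else 2)) => x y.
rewrite /star_dag !inE negb_or => /orP[/andP[-> /eqP ->]|/and3P[/eqP -> yc yP]].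
  by rewrite (negPf cP) eqxx.
by rewrite (negPf cP) eqxx (negPf yc) (negPf yP).
Qed.

Lemma star_dag_skeleton P : c \notin P -> has_skeleton (star_dag P) S.
Proof.
move=> cP x y; rewrite star_edgeE /star_dag !inE !negb_or.
have [->|xc] := eqVneq x c; have [->|yc] := eqVneq y c;
  rewrite ?eqxx ?(negPf cP) ?andbF ?andbT ?orbF //=.
- by rewrite orNb.
- by rewrite xc orbN.
Qed.

Lemma star_dag_parents P : c \notin P -> [set x | star_dag P x c] = P.
Proof.
move=> cP; apply/setP => x.
by rewrite !inE /star_dag !inE eqxx andbF orbF andbT.
Qed.

Variable I : {set V}.
Hypothesis leafI : forall u : V, u \in I -> is_leaf S u.

Lemma I_neq_center u : u \in I -> u != c.
Proof. by move=> /leafI; apply: contraTneq => ->; apply: center_not_leaf. Qed.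

Section Skeleton.
Variable D : rel V.
Hypotheses (dagD : is_dag D) (skelD : has_skeleton D S).

Lemma star_dag_arrow x y : D x y -> (x == c) || (y == c).
Proof.
by move=> Dxy; have := skelD x y; rewrite Dxy star_edgeE => /andP[].
Qed.

Lemma arrow_from_center u : u != c -> D c u = ~~ D u c.
Proof.
move=> uc; have := skelD c u; rewrite star_edgeE eqxx eq_sym uc /=.
by have [/(dag_asym dagD) ->|_] := boolP (D u c); rewrite ?orbF.
Qed.

(** Only [c] can be the sink: a leaf has at most [c] as a parent, which would force [A] to have at
    most two elements. *)
Lemma char_imset_lift (A : {set V}) : c \in A -> (3 <= #|A|)%N ->
  char_imset (intervention (I := I) D) (lift_set I A) =
  (A :\ c \subset [set x | D x c]).
Proof.
move=> cA A3; apply/idP/idP.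
  case/exists_inP => _ /imsetP[a aA ->] /forall_inP pa.
  have pa' b : b \in A -> b != a -> D b a.
    move=> bA ba; apply: (pa (inl b)).
    by rewrite !inE imset_f // andbT (inj_eq (@inl_inj _ _)).
  have [ac|ac] := eqVneq a c.
    by subst a; apply/subsetP => b; rewrite !inE => /andP[bc bA]; apply: pa'.
  have /subset_leq_card : A \subset [set a; c].
    apply/subsetP => b bA; rewrite !inE; have [//|ba /=] := eqVneq b a.
    by have := star_dag_arrow (pa' b bA ba); rewrite (negPf ac) orbF.
  by rewrite cards2 ac leqNgt A3.
move=> /subsetP AP; apply/exists_inP; exists (inl c); first exact: imset_f.
apply/forall_inP => x; rewrite !inE => /andP[xc /imsetP[b bA xb]].
have bc : b != c by apply: contra_neq xc => bc; rewrite xb bc.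
by have := AP b; rewrite !inE bA bc xb => /(_ isT).
Qed.

(** Only [u] can be the sink, since the added node has no parents and is not a parent of [c]; the
    condition left is the arrow from [c] to [u]. *)
Lemma char_imset_arrow (u : {x : V | x \in I}) :
  char_imset (intervention (I := I) D) (arrow_set c u) =
  (val u \notin [set x | D x c]).
Proof.
have uc := I_neq_center (valP u); rewrite inE -arrow_from_center //.
apply/idP/idP => [|Dcu].
  case/exists_inP => x; rewrite !inE -orbA => /or3P[] /eqP-> /forall_inP pa.
  - by have := pa (inr u); rewrite !inE /= eqxx (negPf uc) => /(_ isT).
  - by apply: (pa (inl c)); rewrite !inE eqxx /= andbT (inj_eq (@inl_inj _ _))
      eq_sym.
  - by have := pa (inl c); rewrite !inE eqxx => /(_ isT).
apply/exists_inP; exists (inl (val u)); first by rewrite !inE eqxx orbT.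
apply/forall_inP => x; rewrite !inE -orbA => /andP[xu] /or3P[] /eqP xE.
- by rewrite xE.
- by rewrite xE eqxx in xu.
- by rewrite xE /=.
Qed.
End Skeleton.
End StarDags.

(** * The coordinate space, its dimension, and the slacks *)

Section Coordinates.
Variables (R : realFieldType) (V : finType) (c : V) (I : {set V}).
Local Notation point := {ffun Defs.coord c I -> R^o}.
Local Notation fullpoint := {ffun {set inode I} -> R^o}.
Implicit Types (x y : point) (A : {set V}).

(** [restrict] under a name that can carry a linear structure. *)
Definition restriction : fullpoint -> point := @restrict R V c I.

Lemma restriction_is_linear : linear restriction.
Proof. by move=> a x y; apply/ffunP => k; rewrite !ffunE. Qed.

HB.instance Definition _ := GRing.isLinear.Build R fullpoint point *:%R
  restriction restriction_is_linear.

Lemma restrict_xset (z : fullpoint) A : c \in A -> (3 <= #|A|)%N ->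
  xset (restriction z) A = z (lift_set I A).
Proof.
move=> cA A3; have cA' := is_coord_lift I cA A3.
by rewrite /xset /entry insubT ffunE.
Qed.

Lemma restrict_xarrow (z : fullpoint) u :
  xarrow (restriction z) u = z (arrow_set c u).
Proof.
by rewrite /xarrow /entry insubT ?is_coord_arrow // => ?; rewrite ffunE.
Qed.

Lemma point_ext x y :
  (forall A, c \in A -> (3 <= #|A|)%N -> xset x A = xset y A) ->
  (forall u, xarrow x u = xarrow y u) -> x = y.
Proof.
move=> eqA equ; apply/ffunP => k.
suff: entry x (val k) = entry y (val k) by rewrite /entry valK.
case/orP: (valP k) => [/existsP[A /and3P[cA A3 /eqP ->]]|/existsP[u /eqP ->]].
  exact: eqA.
exact: equ.
Qed.

(** Off the coordinates [entry] is constantly 0, hence still affine, so the sums in the inequalities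
    can be treated termwise for arbitrary sets. *)
Lemma entry_affine B : affine (fun x => entry x B).
Proof.
move=> a x y; rewrite /entry; case: insubP => [k _ _|_].
  by rewrite !ffunE mulr0 subr0.
by rewrite !mulr0 addr0 subr0.
Qed.

(** The map [h] covers all coordinates. The bound is one less than the number of inequalities, as
    duality requires. *)
Lemma dim_point : (\dim {:point} <= #|star_index c| + #|I|)%N.
Proof.
have -> : \dim {:point} = #|Defs.coord c I|.
  by rewrite dimvf /dim /= muln1.
pose h (j : star_index c + {x : V | x \in I}) : {set inode I} :=
  match j with inl B => lift_set I (val B) | inr u => arrow_set c u end.
have -> : (#|star_index c| + #|I| =
    #|{: star_index c + {x : V | x \in I}}|)%N.
  by rewrite card_sum; congr (_ + _)%N; rewrite card_sig; apply: eq_card.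
rewrite -(card_imset _ val_inj) /=.
apply: leq_trans (leq_imset_card h predT); apply: subset_leq_card.
apply/subsetP => _ /imsetP[[B /= HB] _ ->]; apply/imsetP.
case/orP: HB => [/existsP[A /and3P[cA A3 /eqP ->]]|/existsP[u /eqP ->]].
  have HA : (c \in A) && (3 <= #|A|)%N by rewrite cA.
  by exists (inl (Sub A HA)).
by exists (inr u).
Qed.

Definition slack (j : ineq_index c I) (x : point) : R :=
  match j with
  | inl (inl B) => star_lhs (val B) x
  | inl (inr u) => 1 - bidirected_lhs u x
  | inr tt => 1 + sharpI x - forked_lhs x
  end.

Lemma ineqE j : ineq R c I j = [set x | 0 <= slack j x]%classic.
Proof.
by case: j => [[B|u]|[]] //; apply/seteqP; split=> x /=; rewrite subr_ge0.
Qed.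

Lemma slack_affine j : affine (slack j).
Proof.
have affA B : affine (fun x => xset x B) by apply: entry_affine.
have affu u : affine (fun x => xarrow x u) by apply: entry_affine.
case: j => [[B|u]|[]] /=.
- by apply: affine_sum => A _; apply: affineM.
- apply: affineB; first exact: affine_cst.
  by apply: affineD => //; apply: affine_sum => A _; apply: affineM.
- apply: affineB; apply: affineD.
  + exact: affine_cst.
  + by apply: affine_sum => A _; apply: affineM.
  + by apply: affine_sum => A _; apply: affine_sum => B _; apply: affineM.
  + apply: affine_sum => u _; apply: affineB => //; exact: affine_cst.
Qed.

End Coordinates.

(** * Values of the slacks at the point of a parent set [P] *)

Section Evaluation.
Variables (R : realFieldType) (V : finType) (c : V) (I P : {set V}).
Variable x : {ffun Defs.coord c I -> R^o}.
Hypotheses (cI : c \notin I) (cP : c \notin P).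
Hypothesis xsetE : forall A : {set V}, c \in A -> (3 <= #|A|)%N ->
  xset x A = (A \subset c |: P)%:R.
Hypothesis xarrowE : forall u, xarrow x u = (val u \notin P)%:R.
Implicit Types A B Q : {set V}.

Lemma sum_center (F : {set V} -> R) Q : c \notin Q ->
  \sum_(A : {set V} | [&& c \in A, A \subset c |: Q & (3 <= #|A|)%N]) F A =
  \sum_(A : {set V} | (A \subset Q) && (2 <= #|A|)%N) F (c |: A).
Proof.
move=> cQ.
under eq_bigl do rewrite andbA -sub1set.
rewrite big_mkcondr sum_interval ?subsetUl // setU1K // [RHS]big_mkcondr /=.
apply: eq_bigr => A AQ; rewrite cardsU1.
by rewrite (contra (subsetP AQ c) cQ).
Qed.

(** At this point [xset] cuts the sum down to the interval from [B] to [c |: P]. *)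
Lemma star_eval B : c \in B -> (3 <= #|B|)%N ->
  star_lhs B x = (B == c |: P)%:R.
Proof.
move=> cB B3; rewrite /star_lhs -sum_sign_interval [RHS]big_mkcondr.
apply: eq_bigr => A BA; rewrite xsetE ?(subsetP BA) //.
  by rewrite mulr_natr mulrb.
exact: leq_trans B3 (subset_leq_card BA).
Qed.

(** If [u] is not in [P], the arrow coordinate is 1 and the sum vanishes. Otherwise the arrow
    coordinate is 0, and the sum over nonempty subsets of [P :\ u] is 1 unless that set is empty. *)
Lemma bidirected_eval u : 1 - bidirected_lhs u x = (P == [set val u])%:R.
Proof.
have uc : val u != c by apply: contraNneq cI => <-; apply: valP.
rewrite /bidirected_lhs xarrowE.
have -> : \sum_(A : {set V} | (A != set0) && (A \subset ~: [set val u; c]))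
    (-1) ^+ #|A|.+1 * xset x (A :|: [set val u; c]) =
    if val u \in P then 1 - (P :\ val u == set0)%:R else 0.
  have E A : (A != set0) && (A \subset ~: [set val u; c]) ->
      xset x (A :|: [set val u; c]) =
      ((val u \in P) && (A \subset P :\ val u))%:R.
    case/andP=> A0 Auc; rewrite xsetE ?inE ?eqxx ?orbT //; last first.
      rewrite cardsU disjoint_setI0 ?cards0 ?subn0; last first.
        by rewrite disjoints_subset.
      by rewrite cards2 uc addn2 !ltnS card_gt0.
    rewrite subUset subUset !sub1set !inE eqxx (negPf uc) /= andbT andbC.
    congr (_%:R); congr (_ && _).
    apply/subsetP/subsetP => H y yA; have := subsetP Auc y yA; have := H y yA;
      rewrite !inE ?negb_or.
      by case: (y == c); case: (y == val u).
    by case/andP=> _ ->; rewrite orbT.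
  case: ifP => [uP|uP].
    rewrite -sum_sign_nonempty.
    rewrite (eq_bigr (fun A : {set V} =>
      if A \subset P :\ val u then (-1) ^+ #|A|.+1 else 0));
      last by move=> A /E ->; rewrite uP mulr_natr mulrb.
    rewrite -big_mkcondr; apply: eq_bigl => A; rewrite -andbA; congr (_ && _).
    apply/andP/idP => [[]//|AP]; split=> //; apply: subset_trans AP _.
    apply/subsetP => y; rewrite !inE => /andP[yu yP]; rewrite negb_or yu.
    by apply: contraNneq cP => <-.
  by rewrite big1 // => A /E ->; rewrite uP mulr0.
case: ifP => uP.
  rewrite add0r opprD opprK addrA subrr add0r.
  rewrite setD_eq0 subset1; congr (_%:R); case: eqP => //= _.
  by case: (eqVneq P set0) => // P0; rewrite P0 inE in uP.
rewrite addr0 subrr; case: eqP => // PE.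
by rewrite PE inE eqxx in uP.
Qed.

(** Removing [c] leaves the subsets of [P :&: I] of size at least 2, and absorbs the -1 in the
    exponent. *)
Lemma sharp_eval :
  sharpI x = (P :&: I == set0)%:R - 1 + #|P :&: I|%:R.
Proof.
rewrite -sum_sign_ge2.
transitivity (\sum_(A : {set V} |
    [&& c \in A, A \subset c |: P :&: I & (3 <= #|A|)%N])
  (-1) ^+ (#|A| - 1) : R).
  rewrite /sharpI.
  rewrite (eq_bigr (fun A : {set V} =>
    if A \subset c |: P then (-1) ^+ (#|A| - 1) else 0)); last first.
    by move=> A /and3P[cA _ A3]; rewrite xsetE // mulr_natr mulrb.
  rewrite -big_mkcondr; apply: eq_bigl => A.
  by rewrite setUIr subsetI;
    case: (c \in A) (A \subset _) (3 <= _)%N (A \subset _) => [] [] [] [].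
rewrite sum_center ?inE ?(negPf cP) //; apply: eq_bigr => A /andP[AP _].
rewrite cardsU1; have -> : c \notin A.
  by apply: contra cP => /(subsetP AP); rewrite inE => /andP[].
by rewrite add1n subn1.
Qed.

(** For fixed [A] the inner sum alternates over subsets of [P :&: I], so it vanishes unless [P]
    misses [I]. The outer sum, with [c] removed from [A], is then [sum_sign_pred] on [P :\: I]. *)
Lemma toward_eval :
  toward_leaves I x = ((P :&: I == set0) && (2 <= #|P :\: I|)%N)%:R.
Proof.
have inner A : [&& c \in A, A \subset ~: I & (3 <= #|A|)%N] ->
    \sum_(B : {set V} | B \subset I)
      (-1) ^+ (#|A :|: B| - 1) * (#|A| - 2)%:R * xset x (A :|: B) =
    if A \subset c |: P
    then (-1) ^+ (#|A| - 1) * (#|A| - 2)%:R * (P :&: I == set0)%:R else 0.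
  case/and3P=> cA AI A3.
  have E B : B \subset I ->
      (-1) ^+ (#|A :|: B| - 1) * (#|A| - 2)%:R * xset x (A :|: B) =
      if A \subset c |: P then (-1) ^+ (#|A| - 1) * (#|A| - 2)%:R *
        (if B \subset P then (-1) ^+ #|B| else 0) else 0.
    move=> BI; rewrite xsetE ?inE ?cA //; last first.
      by apply: leq_trans A3 _; apply/subset_leq_card/subsetUl.
    rewrite subUset.
    have -> : (B \subset c |: P) = (B \subset P).
      rewrite -subDset (_ : B :\: [set c] = B) //; apply/setDidPl.
      by rewrite disjoint_sym disjoints1; apply: contra cI; apply: subsetP.
    case: (A \subset _); case: (B \subset P); rewrite /= ?mulr0 // mulr1.
    (* [A] and [B] are disjoint, so the sign factors; [A] is nonempty, so the truncated subtraction
       can be moved onto [#|A|]. *)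
    rewrite cardsU disjoint_setI0 ?cards0 ?subn0; last first.
      rewrite disjoints_subset; apply: subset_trans AI _.
      by rewrite setCS.
    by rewrite addnC -addnBA ?(leq_trans _ A3) // exprD -mulrA mulrC.
  rewrite (eq_bigr _ E); case: ifP => _; last by rewrite big1.
  by rewrite -mulr_sumr -big_mkcondr -sum_sign; congr (_ * _);
    apply: eq_bigl => B; rewrite subsetI andbC.
rewrite /toward_leaves (eq_bigr _ inner) -big_mkcondr.
transitivity (\sum_(A : {set V} |
    [&& c \in A, A \subset c |: P :\: I & (3 <= #|A|)%N])
  (-1) ^+ (#|A| - 1) * (#|A| - 2)%:R * (P :&: I == set0)%:R : R).
  apply: eq_bigl => A.
  have -> : (A \subset c |: P :\: I) = (A \subset ~: I) && (A \subset c |: P).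
    rewrite -subsetI; congr (_ \subset pred_of_set _); apply/setP => y.
    rewrite !inE; have [->|//] := eqVneq y c; by rewrite cI.
  by case: (c \in A) (A \subset _) (3 <= _)%N (A \subset _) => [] [] [] [].
rewrite sum_center ?inE ?(negPf cP) ?andbF // -mulr_suml andbC -mulnb natrM.
congr (_ * _); rewrite -sum_sign_pred; apply: eq_bigr => A /andP[AP _].
rewrite cardsU1; case: (boolP (c \in A)) => [/(subsetP AP)|_].
  by rewrite !inE (negPf cP) andbF.
by rewrite add1n subn1 subSS.
Qed.

(** The arrow terms sum to [#|P :&: I|], which cancels the same term of [sharp_eval]; what remains
    is the indicator that [P] misses [I], minus [toward_eval]. *)
Lemma forked_eval :
  1 + sharpI x - forked_lhs x =
  ((P :&: I == set0) && (#|P :\: I| <= 1)%N)%:R.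
Proof.
have E : \sum_(u : {v : V | v \in I}) (1 - xarrow x u) = #|P :&: I|%:R.
  under eq_bigr do rewrite xarrowE.
  rewrite -(big_sub I (fun v => 1 - (v \notin P)%:R)) -sum1_card natr_sum.
  rewrite big_mkcond [RHS]big_mkcond; apply: eq_bigr => v _.
  by rewrite inE; case: (v \in I); case: (v \in P); rewrite ?subr0 ?subrr.
rewrite /forked_lhs E toward_eval sharp_eval.
rewrite addrCA addrA subrK opprD addrACA subrr addr0 [in RHS]leqNgt.
by case: eqP; case: (1 < _)%N => _ /=; rewrite ?subr0 ?subrr.
Qed.

End Evaluation.

(** * The vertices of the polytope and their duality with the slacks *)

Section Vertices.
Variables (R : realFieldType) (V : finType) (S : rel V) (c : V) (I : {set V}).
Hypothesis starS : star_graph S c.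
Hypothesis leafI : forall u : V, u \in I -> is_leaf S u.
Local Notation point := {ffun Defs.coord c I -> R^o}.
Implicit Types P : {set V}.

Let cI : c \notin I.
Proof. by apply/negP => /leafI; apply/negP/center_not_leaf. Qed.

Definition dag_point (D : rel V) : point :=
  restriction c (imset_vector R (intervention (I := I) D)).

Definition vertex P : point := dag_point (star_dag c P).

Lemma dag_point_xset D (A : {set V}) : is_dag D -> has_skeleton D S ->
  c \in A -> (3 <= #|A|)%N ->
  xset (dag_point D) A = (A \subset c |: [set x | D x c])%:R.
Proof.
move=> dagD skelD cA A3.
by rewrite restrict_xset // ffunE (char_imset_lift starS) // subDset.
Qed.

Lemma dag_point_xarrow D u : is_dag D -> has_skeleton D S ->
  xarrow (dag_point D) u = (val u \notin [set x | D x c])%:R.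
Proof.
by move=> dagD skelD; rewrite restrict_xarrow ffunE (char_imset_arrow starS).
Qed.

Lemma vertex_xset P (A : {set V}) : c \notin P -> c \in A -> (3 <= #|A|)%N ->
  xset (vertex P) A = (A \subset c |: P)%:R.
Proof.
move=> cP cA A3; rewrite dag_point_xset ?star_dag_parents //.
  exact: star_dag_dag.
exact: star_dag_skeleton.
Qed.

Lemma vertex_xarrow P u : c \notin P ->
  xarrow (vertex P) u = (val u \notin P)%:R.
Proof.
move=> cP; rewrite dag_point_xarrow ?star_dag_parents //.
  exact: star_dag_dag.
exact: star_dag_skeleton.
Qed.

Lemma dag_pointE D : is_dag D -> has_skeleton D S ->
  dag_point D = vertex [set x | D x c].
Proof.
move=> dagD skelD; have cP : c \notin [set x | D x c] by rewrite inE dag_irr.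
apply: point_ext => [A cA A3|u]; first by rewrite dag_point_xset ?vertex_xset.
by rewrite dag_point_xarrow ?vertex_xarrow.
Qed.

(** A parent set representing the vertex opposite to the facet of [j]. *)
Definition parent_set (j : ineq_index c I) : {set V} :=
  match j with
  | inl (inl B) => val B :\ c
  | inl (inr u) => [set val u]
  | inr tt => set0
  end.

Lemma center_parent_set j : c \notin parent_set j.
Proof.
case: j => [[B|u]|[]] /=; rewrite !inE ?eqxx //.
by apply: contraNneq cI => ->; apply: valP.
Qed.

(* When no node of I and at most one other leaf points to c, the vertex is that
   of the empty parent set. *)
Lemma vertex_parent_set P : c \notin P ->
  exists j, vertex P = vertex (parent_set j).
Proof.
move=> cP; have [P2|P1] := leqP 2 #|P|.
  have BP : (c \in c |: P) && (3 <= #|c |: P|)%N.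
    by rewrite setU11 cardsU1 cP add1n ltnS.
  by exists (inl (inl (Sub (c |: P) BP))); rewrite /= setU1K.
have [PI|[u]] := set_0Vmem (P :&: I); last first.
  rewrite inE => /andP[uP uI]; exists (inl (inr (Sub u uI))) => /=.
  congr vertex.
  by apply/eqP; rewrite eq_sym eqEcard sub1set uP cards1 -ltnS.
exists (inr tt); apply: point_ext => [A cA A3|u] /=.
  (* With at most one parent, [c |: Q] has at most two elements, so all coordinates [xset]
     vanish. *)
  have small (Q : {set V}) : (#|Q| <= 1)%N -> (A \subset c |: Q) = false.
    move=> Q1; apply/negbTE; apply: contraTN A3 => /subset_leq_card.
    rewrite cardsU1 -leqNgt => /leq_trans; apply.
    by apply: (@leq_add _ _ 1 1) => //; case: (c \in Q).
  by rewrite !vertex_xset ?inE // !small // cards0.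
rewrite !vertex_xarrow ?inE //; congr (_%:R); congr nat_of_bool.
apply/negP => uP; have : val u \in P :&: I by rewrite inE uP; apply: valP.
by rewrite PI inE.
Qed.

Lemma slack_vertex j P : c \notin P -> slack j (vertex P) =
  match j with
  | inl (inl B) => (val B == c |: P)%:R
  | inl (inr u) => (P == [set val u])%:R
  | inr tt => ((P :&: I == set0) && (#|P :\: I| <= 1)%N)%:R
  end.
Proof.
move=> cP; have xE A := @vertex_xset P A cP.
have uE u := @vertex_xarrow P u cP.
case: j => [[B|u]|[]] /=.
- by case/andP: (valP B) => cB B3; apply: star_eval.
- exact: bidirected_eval.
- exact: forked_eval.
Qed.

(** The parent sets of star indices have at least two elements, which separates them from the
    singletons and the empty set; one that misses [I] also has two elements outside [I], so its
    forked-tree slack is 0. *)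
Lemma slack_dual j k : slack j (vertex (parent_set k)) = (j == k)%:R.
Proof.
rewrite slack_vertex ?center_parent_set //.
have B2 (B : star_index c) : (2 <= #|sval B :\ c|)%N.
  by case/andP: (valP B) => cB; rewrite (cardsD1 c) cB.
case: j k => [[B|u]|[]] [[B'|u']|[]] /=.
- by case/andP: (valP B') => cB' _; rewrite setD1K.
- case: eqP => // BE; have := B2 B.
  by rewrite BE setU1K ?cards1 // (center_parent_set (inl (inr u'))).
- by case: eqP => // BE; have := B2 B; rewrite BE setU1K ?inE ?cards0.
- by case: eqP => // BE; have := B2 B'; rewrite BE cards1.
- by rewrite (inj_eq set1_inj) eq_sym.
- by case: eqP => // /setP/(_ (val u)); rewrite !inE eqxx.
- case: eqP => //= PI; rewrite leqNgt.
  suff -> : (val B' :\ c) :\: I = val B' :\ c by rewrite B2.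
  by apply/setDidPl; rewrite -setI_eq0 PI.
- case: eqP => // /setP/(_ (val u')); rewrite !inE eqxx /=.
  by rewrite (valP u').
- by rewrite set0I set0D cards0 eqxx.
Qed.

Lemma CIM_vertices :
  CIM R S c I = conv_hull (range (fun j => vertex (parent_set j))).
Proof.
rewrite [LHS](conv_hull_linear_image (@restriction R V c I)); congr conv_hull.
apply/seteqP; split=> x.
  case=> _ [D [dagD skelD] <-] <-.
  have [|j jE] := @vertex_parent_set [set x | D x c].
    by rewrite inE dag_irr.
  by exists j => //; rewrite -jE -dag_pointE.
case=> j _ <-; have cP := center_parent_set j.
exists (imset_vector R (intervention (star_dag c (parent_set j)))) => //.
exists (star_dag c (parent_set j)) => //; split.
  exact: star_dag_dag.
exact: star_dag_skeleton.
Qed.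

End Vertices.

Theorem theorem5p18 (R : realFieldType) (V : finType) (S : rel V) (c : V)
    (I : {set V}) (starS : star_graph S c)
    (leafI : forall u : V, u \in I -> is_leaf S u) :
  minimal_H_representation (CIM R S c I) (ineq R c I) /\
  is_simplex (CIM R S c I).
Proof.
pose p j := vertex R c I (parent_set j).
have dual := slack_dual R starS leafI.
have aff := @slack_affine R V c I.
(* The forked-tree inequality is the one in excess of the coordinates. *)
have cardJ : #|ineq_index c I| = (#|star_index c| + #|I|).+1.
  rewrite !card_sum card_unit addn1; congr (_ + _).+1.
  by rewrite card_sig; apply: eq_card.
have dimE : (\dim {:{ffun Defs.coord c I -> R^o}} < #|ineq_index c I|)%N.
  by rewrite cardJ ltnS dim_point.
have J2 : (1 < #|ineq_index c I|)%N.
  (* The whole node set is a star index, as a star has at least three nodes. *)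
  rewrite cardJ ltnS addn_gt0; apply/orP; left.
  have [_ V3 _] := starS.
  have TV : (c \in [set: V]) && (3 <= #|[set: V]|)%N by rewrite inE cardsT.
  by apply/card_gt0P; exists (Sub [set: V] TV).
rewrite (CIM_vertices R starS leafI).
have -> : ineq R c I = (fun j => [set x | 0 <= slack j x]%classic).
  by apply: boolp.funext => j; apply: ineqE.
split; first exact: dual_minimal_H_representation.
exact: (dual_is_simplex aff).
Qed.
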